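(* For every integer $n\ge1$, $$\sum_{w\in\mathfrak{S}_n(231)}q^{\mathrm{wt}'(D(w))}=q^{\binom n2}C_n(q^{-1}),$$ where $D(w)$ is the Dyck tiling of the region $R$ corresponding to $w$.
   Context: **Permutations.** $\mathfrak{S}_n(231)$ is the set of permutations $w=w_1\cdots w_n$ of $\{1,\ldots,n\}$ with no $i<j<k$ such that $w_k<w_i<w_j$. **$q$-Catalan numbers.** $C_n=C_n(q)$, $n\ge0$, are the polynomials defined by $z=\sum_{n=1}^{\infty}C_{n-1}(q)z^n(1-z)(1-qz)\cdots(1-q^{n-1}z)$. **The region $R$.** In the plane, $0$ denotes a step $(1,1)$ and $1$ a step $(1,-1)$. Let $\lambda_b=(01)^n$ start at $(0,0)$ and end at $(2n,0)$, and let $\lambda_t=1^{2n}$ start at $(0,2n)$ and end at $(2n,0)$. The region $R$ bounded by $\lambda_b$, $\lambda_t$ and $x=0$ is filled with unit squares rotated by 45 degrees, the square with center $(x,y)$ having vertices $(x\pm1,y)$, $(x,y\pm1)$; the squares are those with integer centers $(x,y)$, $x\ge 0$, $y\ge 1$, $x+y$ odd, $x+y\le 2n-1$. The squares centered on $x=0$ are called anchor boxes and are labeled $1,\ldots,n$ from top to bottom, so the anchor box labeled $i$ has center $(0,2(n-i)+1)$. **Dyck tilings.** A Dyck tile is a ribbon (connected skew shape of squares with no $2\times2$ block of squares) such that the line joining consecutive centers of its squares is a Dyck path (starting and ending at the same height, with steps $(1,1)$ and $(1,-1)$, never going below its starting height). The size of a Dyck tile is the size (half the number of steps) of this Dyck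 path, so a tile with $2k+1$ squares has size $k$ and a single square has size $0$. A Dyck tiling of $R$ is a tiling $D$ of the squares of $R$ by Dyck tiles which is cover-inclusive: for each tile $d$ of $D$, the translate of $d$ by $(0,-2)$ is contained in another tile of $D$ or is below $\lambda_b$. **Tilings and permutations.** The entry of a tile is the north-west edge of its left-most square and its exit is the south-east edge of its right-most square; the tile carries a trajectory running inside it from entry to exit. For each $i$, start at the entry of the tile containing the anchor box labeled $i$ and follow its trajectory; whenever the exit reached coincides with the entry of another tile, continue along that tile's trajectory. The trajectory ends when the exit coincides with an up step of $\lambda_b$, or with an up step (edge in direction $(1,1)$) of the boundary of another tile which is not that tile's entry. In the first case write $i$ below the peak of $\lambda_b$ at the end of that up step; in the second case write $i$ below the peak of $\lambda_b$ lying vertically below that edge (the peak ending the up step of $\lambda_b$ obtained by translating the edge vertically downward). This places each of $1,\ldots,n$ below exactly one of the $n$ peaks of $\lambda_b$, and reading the integers at the peaks from right to left gives a permutation. This is a bijection between Dyck tilings of $R$ and permutations of $\{1,\ldots,n\}$; $D(w)$ is the Dyck tiling whose permutation is $w$. **Weight.** $\mathrm{wt}'(d):=k$ for a Dyck tile $d$ of size $k\ge0$, and $\mathrm{wt}'(D):=\sum_{d\in D}\mathrm{wt}'(d)$, the sum over all tiles of $D$. *)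

(* Defs.v *)
From mathcomp Require Import all_boot all_order all_algebra all_fingroup zify.
Set Implicit Arguments.
Unset Strict Implicit.
Unset Printing Implicit Defensive.
Import GRing.Theory.

Local Open Scope nat_scope.

(* Labels, positions and entries of permutations are shifted by one: an        *)
(* element i of 'I_n stands for the integer i + 1, and w : 'S_n for the word   *)
(* w_1 ... w_n with w_(j + 1) = w j + 1.                                        *)
Definition avoids231 (n : nat) (w : 'S_n) : bool :=
  ~~ [exists i : 'I_n, exists j : 'I_n, exists k : 'I_n,
        [&& i < j, j < k, w k < w i & w i < w j]].

Section QCatalan.

Local Open Scope ring_scope.

(* Convergence of the series with general term t (n >= 1) to f in the ring of *)
(* formal power series R[[z]]: every coefficient of the partial sums is        *)
(* eventually that of f.                                                       *)
Definition fps_series_to (R : nzRingType) (t : nat -> {poly R}) (f : {poly R}) :=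
  forall m : nat, exists N0 : nat, forall N : nat, (N0 <= N)%N ->
    (\sum_(1 <= n < N) t n)`_m = f`_m.

(* In {poly {poly int}} the outer indeterminate is z and the inner one is q.   *)
Definition qfactor (n : nat) : {poly {poly int}} :=
  \prod_(j < n) (1 - ('X^j)%:P * 'X).

Definition qCatalan (C : nat -> {poly int}) : Prop :=
  fps_series_to (fun n => (C n.-1)%:P * 'X^n * qfactor n) 'X.

(* The defining identity determines the sequence C, coefficient by coefficient. *)
Lemma qCatalanP C :
  qCatalan C <-> forall m : nat,
    \sum_(i < m.+1) C i * (qfactor i.+1)`_(m - i) = (m == 0%N)%:R.
Proof.
have coefS m N : (m < N)%N -> (\sum_(1 <= n < N.+1)
    (C n.-1)%:P * 'X^n * qfactor n)`_m.+1
  = \sum_(i < m.+1) C i * (qfactor i.+1)`_(m - i).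
  move=> mN; rewrite coef_sum big_add1 /= (big_cat_nat (n := m.+1)) //=.
  rewrite [X in _ + X]big_nat_cond [X in _ + X]big1 => [|i]; last first.
    by case/andP=> /andP[mi _] _; rewrite -mulrA coefCM coefXnM ltnS mi mulr0.
  rewrite addr0 big_mkord; apply: eq_bigr => i _.
  by rewrite -mulrA coefCM coefXnM ltnS ltnNge -ltnS ltn_ord /= subSS.
split=> [CP m|CP [|m]].
- have [N0 /(_ (maxn N0 m.+2) (leq_maxl _ _))] := CP m.+1.
  have : (m.+2 <= maxn N0 m.+2)%N by exact: leq_maxr.
  by case: (maxn N0 m.+2) => // N mN; rewrite coefS // coefX.
- exists 0%N => N _; rewrite coefX coef_sum big_nat_cond big1 //.
  by case=> // i _; rewrite -mulrA coefCM coefXnM mulr0.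
- exists m.+2 => [[|N]] // mN; rewrite coefS // CP coefX //.
Qed.

Lemma qfactor_coef0 k : (qfactor k)`_0 = 1.
Proof.
rewrite -horner_coef0 horner_prod big1 // => i _.
by rewrite hornerD hornerN hornerM hornerX mulr0 subr0 hornerC.
Qed.

Lemma qCatalan_exists : exists C, qCatalan C.
Proof.
pose step (m : nat) (s : seq {poly int}) := (m == 0%N)%:R
  - \sum_(i < m) s`_i * (qfactor i.+1)`_(m - i).
pose g := fix g m := if m is k.+1 then rcons (g k) (step k (g k)) else [::].
have size_g m : size (g m) = m by elim: m => //= m IH; rewrite size_rcons IH.
have gE m i : (i < m)%N -> (g m)`_i = step i (g i).
  elim: m => // m IH; rewrite ltnS leq_eqVlt /= nth_rcons size_g.
  by case/orP => [/eqP->|im]; [rewrite ltnn eqxx | rewrite im IH].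
exists (fun m => step m (g m)); apply/qCatalanP => m.
rewrite big_ord_recr /= subnn qfactor_coef0 mulr1 {2}/step addrC -addrA.
rewrite [X in _ + X](_ : _ = 0) ?addr0 //; apply/eqP.
by rewrite addrC subr_eq0; apply/eqP/eq_bigr => i _; rewrite gE.
Qed.

Lemma qCatalan_unique C C' : qCatalan C -> qCatalan C' -> C =1 C'.
Proof.
move=> /qCatalanP CP /qCatalanP CP' m; elim/ltn_ind: m => m IH.
have := CP m; rewrite -CP' !big_ord_recr /= subnn qfactor_coef0 !mulr1.
rewrite (eq_bigr (fun i : 'I_m => C' i * (qfactor i.+1)`_(m - i))) => [|i _].
  exact: addrI.
by rewrite IH.
Qed.

End QCatalan.

(* The type of the squares of R, given by their centers.                       *)
Definition square (n : nat) : Type :=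
  {c : 'I_n.*2 * 'I_n.*2 | [&& 0 < c.2, odd (c.1 + c.2) & c.1 + c.2 <= n.*2.-1]}.

Section DyckTilings.

Variable n : nat.

Implicit Types (s t u l r : square n) (d : {set square n}).

Definition cx s : nat := (val s).1.
Definition cy s : nat := (val s).2.

Definition adjacent s t : bool :=
  (((cx s).+1 == cx t) || ((cx t).+1 == cx s))
  && (((cy s).+1 == cy t) || ((cy t).+1 == cy s)).

Definition connected d : bool :=
  (d != set0) &&
  [forall s in d, forall t in d,
     connect [rel u v | [&& adjacent u v, u \in d & v \in d]] s t].

(* The order of the squares as cells of Z^2, in the coordinates y - x and      *)
(* y + x; Young diagrams are its down-sets, and the skew shapes, differences   *)
(* of two of them, are its convex subsets.                                     *)
Definition cell_le s t : bool :=
  (cy s + cx t <= cy t + cx s) && (cy s + cx s <= cy t + cx t).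

Definition skew_shape d : bool :=
  [forall s in d, forall u in d, forall t,
     cell_le s t && cell_le t u ==> (t \in d)].

Definition has_2x2_block d : bool :=
  [exists s in d, exists t in d, exists l in d, exists r in d,
     [&& cx t == cx s, cy t == (cy s).+2,
         (cx l).+1 == cx s, cy l == (cy s).+1,
         cx r == (cx s).+1 & cy r == (cy s).+1]].

Definition ribbon d : bool :=
  [&& connected d, skew_shape d & ~~ has_2x2_block d].

Definition squares_of d : seq (square n) :=
  sort (fun s t => cx s <= cx t) (enum d).

Definition dyck_step s t : bool :=
  (cx t == (cx s).+1) && ((cy t == (cy s).+1) || (cy s == (cy t).+1)).

Definition dyck_path (p : seq (square n)) : bool :=
  if p is s :: p' then
    [&& path dyck_step s p', cy (last s p') == cy s & all (fun t => cy s <= cy t) p']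
  else false.

Definition dyck_tile d : bool := ribbon d && dyck_path (squares_of d).

(* Conversely, squares whose centers form a lattice path always make a ribbon. *)
Lemma dyck_path_ribbon d : dyck_path (squares_of d) -> ribbon d.
Proof.
have memd x : (x \in squares_of d) = (x \in d) by rewrite mem_sort mem_enum.
move: (squares_of d) memd => [|h p] memd //= /and3P[hp _ _].
pose L : rel (square n) := fun s u => [&& cx s < cx u,
  cy u + cx s <= cy s + cx u & cy s + cx s <= cy u + cx u].
have Ltr : transitive L by move=> b a c /and3P[] ? ? ? /and3P[] ? ? ?; rewrite /L; lia.
have hL : sorted L (h :: p).
  by apply: (sub_path _ hp) => a b /andP[/eqP h1 /orP[]/eqP h2]; rewrite /L; lia.
have total s u : s \in d -> u \in d -> [\/ s = u, L s u | L u s].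
  rewrite -!memd => sp up; move: hL; rewrite sorted_pairwise // => /(pairwiseP h) pw.
  have [su|us|e] := ltngtP (index s (h :: p)) (index u (h :: p)).
  - constructor 2; rewrite -(nth_index h sp) -(nth_index h up).
    by apply: pw; rewrite ?inE ?index_mem.
  - constructor 3; rewrite -(nth_index h sp) -(nth_index h up).
    by apply: pw; rewrite ?inE ?index_mem.
  - by constructor 1; rewrite -(nth_index h sp) -(nth_index h up) e.
have nthx i : i < size (h :: p) -> cx (nth h (h :: p) i) = cx h + i.
  elim: i => [|i IH] ip; first by rewrite addn0.
  have := pathP h hp i ip => /andP[/eqP e _].
  by rewrite /= in e *; rewrite e -/(nth h (h :: p) i) IH ?addnS // ltnW.
have mid s u x : s \in d -> u \in d -> cx s <= x <= cx u ->
    exists2 v, v \in d & cx v = x.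
  rewrite -!memd => sp up; rewrite -(nth_index h sp) -(nth_index h up).
  rewrite !nthx ?index_mem // => /andP[h1 h2].
  have lt : x - cx h < size (h :: p).
    apply: (@leq_ltn_trans (index u (h :: p))); last by rewrite index_mem.
    by rewrite leq_subLR.
  by exists (nth h (h :: p) (x - cx h)); rewrite -?memd ?mem_nth // nthx //; lia.
apply/and3P; split.
- apply/andP; split; first by apply/set0Pn; exists h; rewrite -memd mem_head.
  set e := [rel u v | _]; have esym : symmetric e.
    by move=> a b; rewrite /= [(b \in d) && _]andbC; congr (_ && _);
      rewrite /adjacent orbC; congr (_ && _); exact: orbC.
  have conn t : t \in d -> connect e h t.
    rewrite -memd => tp; apply: (path_connect (p := p)) => //.
    apply: (sub_in_path (P := [in d])) hp.
      move=> a b ad bd /andP[/eqP h1 /orP[]/eqP h2];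
      by rewrite /e /= ad bd !andbT /adjacent; lia.
    by apply/allP => z; rewrite memd.
  apply/forall_inP => s sd; apply/forall_inP => t td.
  by apply: connect_trans (conn t td); rewrite (sym_connect_sym esym) conn.
- apply/forall_inP => s sd; apply/forall_inP => u ud; apply/forallP => t.
  apply/implyP => /andP[/andP[h1 h2] /andP[h3 h4]].
  have eqsq v : cx v = cx t -> cy v = cy t -> v = t.
    move=> e1 e2; apply: val_inj; move: e1 e2; rewrite /cx /cy.
    by case: (val v) (val t) => [? ?] [? ?] /= /val_inj-> /val_inj->.
  have [su|su|us] := total s u sd ud.
  - have -> // : t = s by rewrite -(eqsq s) //; subst u; lia.
  - have /and3P[l1 l2 l3] := su.
    have [|v vd ve] := mid s u (cx t) sd ud; first by lia.
    rewrite -(eqsq v) //.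
    have [E1|/and3P[] ? ? ?|/and3P[] ? ? ?] := total s v sd vd;
    have [E2|/and3P[] ? ? ?|/and3P[] ? ? ?] := total v u vd ud;
    try subst s; try subst u; lia.
  - have /and3P[l1 l2 l3] := us.
    have [|v vd ve] := mid u s (cx t) ud sd; first by lia.
    rewrite -(eqsq v) //.
    have [E1|/and3P[] ? ? ?|/and3P[] ? ? ?] := total s v sd vd;
    have [E2|/and3P[] ? ? ?|/and3P[] ? ? ?] := total v u vd ud;
    try subst s; try subst u; lia.
- apply/negP => /exists_inP[s sd] /exists_inP[t td] /exists_inP[l ld].
  case/exists_inP => r rd /and3P[/eqP e1 /eqP e2 _].
  have [E|/and3P[]|/and3P[]] := total s t sd td; [subst t|..]; lia.
Qed.

Definition tile_size d : nat := (#|d|.-1)./2.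

Definition tiling_weight (D : {set {set square n}}) : nat :=
  \sum_(d in D) tile_size d.

(* d' contains the translate of d by (0, -2).                                  *)
Definition contains_translate d d' : bool :=
  [forall s in d, exists t in d', (cx t == cx s) && ((cy t).+2 == cy s)].

(* The translate of the square s has top vertex (cx s, cy s - 1), and the      *)
(* height of lambda_b at the integer abscissa x is odd x.                      *)
Definition translate_below d : bool :=
  [forall s in d, cy s <= (odd (cx s)).+1].

Definition cover_inclusive (D : {set {set square n}}) : bool :=
  [forall d in D,
     [exists d' in D, (d' != d) && contains_translate d d'] || translate_below d].

Definition dyck_tiling (D : {set {set square n}}) : bool :=
  [&& partition D [set: square n], [forall d in D, dyck_tile d]
    & cover_inclusive D].

(* A unit edge in direction (1, 1) is represented by its upper endpoint.       *)
Definition nw_edge s : nat * nat := (cx s, (cy s).+1).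
Definition se_edge s : nat * nat := ((cx s).+1, cy s).

Definition entry d : nat * nat :=
  if squares_of d is s :: _ then nw_edge s else (0, 0).
Definition exit d : nat * nat :=
  if squares_of d is s :: p then se_edge (last s p) else (0, 0).

(* An up edge is on the boundary of d when exactly one of the two squares      *)
(* adjacent to it belongs to d.                                                *)
Definition boundary_up_step d (e : nat * nat) : bool :=
  [exists s in d, nw_edge s == e] (+) [exists s in d, se_edge s == e].

(* The peaks of lambda_b are numbered from left to right, starting from 0.     *)
Definition peak (k : 'I_n) : nat * nat := (k.*2.+1, 1).

Definition is_anchor (i : 'I_n) s : bool :=
  (cx s == 0) && (cy s == (n - i.+1).*2.+1).

Definition continues (D : {set {set square n}}) : rel {set square n} :=
  [rel d d' | [&& d \in D, d' \in D, d' != d & exit d == entry d']].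

(* The up step of lambda_b that ends at the peak k is represented by peak k.   *)
Definition ends_at (D : {set {set square n}}) d (k : 'I_n) : bool :=
  (exit d == peak k)
  || [exists d' in D,
        [&& d' != d, boundary_up_step d' (exit d) & exit d != entry d']]
     && ((exit d).1 == (peak k).1).

Definition label_at (D : {set {set square n}}) (i k : 'I_n) : bool :=
  [exists d0 in D, [exists s in d0, is_anchor i s] &&
     [exists d in D, connect (continues D) d0 d && ends_at D d k]].

(* The peaks are read from right to left.                                      *)
Definition has_permutation (D : {set {set square n}}) (w : 'S_n) : bool :=
  [forall j : 'I_n, label_at D (w j) (rev_ord j)].

Definition tiling_of (w : 'S_n) : {set {set square n}} :=
  odflt set0 [pick D | dyck_tiling D && has_permutation D w].

End DyckTilings.

(* Main.v *)
Require Import Defs.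
From mathcomp Require Import all_boot all_order all_algebra all_fingroup.
From mathcomp Require Import zify ring.
Import GRing.Theory.
Set Implicit Arguments.
Unset Strict Implicit.
Unset Printing Implicit Defensive.

(** Cover-inclusiveness is very rigid over the zigzag path lambda_b. Pushing a
    tile down until it touches lambda_b shows that all its squares follow the
    shape of lambda_b ([tile_level]), so a tile is either one square at an odd
    abscissa or a zigzag running between two even abscissas ([tile_shape]). A
    tiling is therefore known once one knows which squares at odd abscissas are
    joined to their neighbours; in the column of abscissa 2c + 1 these are the
    lowest h(c) squares, for some h(c) <= n - 1 - c ([heights_exist]), and every
    choice of such heights occurs ([dyck_tiling_heights], [has_heights_tiling]).
    A joined square contributes 1 to the weight, which is thus the sum of the
    heights ([weight_heights]).

    A trajectory that arrives at column c on level r stays on this level if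
    r < h(c), stops at the peak c if r = h(c), and goes down one level if
    r > h(c) ([trajectory]). This is the decoding of a Lehmer code: read from
    left to right, the levels of the anchor boxes form a permutation whose Lehmer
    code is h. For the permutation w, read from right to left with the labels
    going down, this says h(c) = m - a(m), where m = n - 1 - c and a(m) is the
    number of l < m with w(l) < w(m) ([has_permutation_heights]). So the weight
    is the number of inversions of w, C(n,2) minus the sum of the a(m)
    ([weight_tiling_of]).

    The code a is an arbitrary sequence with a(m) <= m ([code_surj]), and w avoids
    231 exactly when a is weakly increasing ([avoids231_code]). It remains to see
    that C_n is the sum of q^(a(0) + ... + a(n-1)) over the weakly increasing
    sequences with a(m) <= m ([qCatalan_stair_poly]). The coefficient of z^k in
    (1 - z)...(1 - q^i z) is a signed sum over the k-subsets S of {0, ..., i}; in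
    the identity defining C_n the pairs (a, S) cancel, by moving the largest entry
    of S to the end of a when it is at least the last entry of a, and the last
    entry of a to S otherwise. Algebraically, this involution is a summation by
    parts followed by a telescoping sum. *)

Local Open Scope nat_scope.

(** * Squares of the region *)

Section Squares.
Variable n : nat.
Implicit Types (s t u : square n) (d : {set square n}).

(** Each square sits on a copy of the zigzag lambda_b translated upwards; with the
    abscissa, the index of this copy is a coordinate system in which the parity
    condition on centers disappears ([cyE]). *)
Definition level s : nat := (cy s).-1./2.

Lemma cyE s : cy s = (level s).*2.+1 + odd (cx s).
Proof. by rewrite /level /cx /cy; case: s => [[x y] /= /and3P[? ? ?]]; lia. Qed.

Lemma square_bound s : uphalf (cx s) + level s < n.
Proof. by rewrite /level /cx /cy; case: s => [[x y] /= /and3P[? ? ?]]; lia. Qed.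

Lemma column_proof s : (cx s)./2 < n.
Proof. by have := square_bound s; lia. Qed.
Definition column s : 'I_n := Ordinal (column_proof s).

Lemma square_exists x r : uphalf x + r < n -> exists s, cx s = x /\ level s = r.
Proof.
move=> H; have xn : x < n.*2 by lia.
have yn : r.*2.+1 + odd x < n.*2 by lia.
have ok : [&& 0 < r.*2.+1 + odd x, odd (x + (r.*2.+1 + odd x)) &
   x + (r.*2.+1 + odd x) <= n.*2.-1] by lia.
exists (exist (fun c : 'I_n.*2 * 'I_n.*2 =>
  [&& 0 < c.2, odd (c.1 + c.2) & c.1 + c.2 <= n.*2.-1]) (Ordinal xn, Ordinal yn) ok).
by rewrite /level /cx /cy /=; split=> //; lia.
Qed.

Lemma square_inj s t : cx s = cx t -> level s = level t -> s = t.
Proof.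
move=> ex er; have ey : cy s = cy t by rewrite !cyE ex er.
apply: val_inj; move: ex ey; rewrite /cx /cy.
by case: (val s) (val t) => [? ?] [? ?] /= /val_inj-> /val_inj->.
Qed.

Lemma mem_squares_of d s : (s \in squares_of d) = (s \in d).
Proof. by rewrite mem_sort mem_enum. Qed.

Lemma squares_of_uniq d : uniq (squares_of d).
Proof. by rewrite sort_uniq enum_uniq. Qed.

Lemma size_squares_of d : size (squares_of d) = #|d|.
Proof. by rewrite size_sort cardE. Qed.

Lemma squares_of1 s : squares_of [set s] = [:: s].
Proof. by rewrite /squares_of enum_set1. Qed.

(** The sorting order compares abscissas only, so the list of squares itself is not
    determined by being sorted; its list of abscissas is. *)
Lemma cx_squares_of d x m : {in d &, injective (@cx n)} ->
  (forall y, reflect (exists2 s, s \in d & cx s = y) (y \in iota x m)) ->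
  map (@cx n) (squares_of d) = iota x m.
Proof.
move=> inj mem; apply: (sorted_eq leq_trans anti_leq).
- rewrite sorted_map; apply: (@sort_sorted _ (relpre (@cx n) leq)) => a b;
  exact: leq_total.
- exact: iota_sorted.
- apply: uniq_perm; rewrite ?iota_uniq //.
    rewrite map_inj_in_uniq ?squares_of_uniq // => a b.
    by rewrite !mem_squares_of; exact: inj.
  move=> y; apply/mapP/mem => [[s]|[s]]; first by rewrite mem_squares_of => *;
    exists s.
  by exists s; rewrite ?mem_squares_of.
Qed.

Lemma last_iota x m : last x (iota x.+1 m) = x + m.
Proof. by elim: m x => [|m IH] x /=; rewrite ?addn0 // IH addnS. Qed.

Lemma dyck_path_cx s p : path (@dyck_step n) s p ->
  map (@cx n) (s :: p) = iota (cx s) (size p).+1.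
Proof.
elim: p s => //= t p IH s /andP[/andP[/eqP e _] /IH]; rewrite /= => ->.
by rewrite e.
Qed.

(** The tiles with more than one square will turn out to have this form; a = b gives
    the single squares at even abscissas. *)
Definition zigzag r a b d : Prop :=
  forall s, (s \in d) = (level s == r) && (a.*2 <= cx s <= b.*2).

Section Zigzag.
Variables (r a b : nat) (d : {set square n}).
Hypotheses (ab : a <= b) (bn : b + r < n) (zd : zigzag r a b d).

Lemma cx_zigzag : map (@cx n) (squares_of d) = iota a.*2 (b - a).*2.+1.
Proof.
apply: cx_squares_of => [s t|y].
  by rewrite !zd => /andP[/eqP e1 _] /andP[/eqP e2 _] e; apply: square_inj; lia.
apply: (iffP idP) => [|[s]]; rewrite mem_iota; last by rewrite zd; lia.
move=> H; have [|s [sx sr]] := @square_exists y r; first by lia.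
by exists s; rewrite // zd; lia.
Qed.

Lemma squares_of_zigzag : exists s p, [/\ squares_of d = s :: p,
  cx s = a.*2 & cx (last s p) = b.*2].
Proof.
have := cx_zigzag; case E: (squares_of d) => [|s p] //= [sx E'].
exists s, p; split=> //.
by rewrite -last_map E' sx last_iota; lia.
Qed.
End Zigzag.
End Squares.

(** * Shape of the tiles and heights of a tiling *)

Lemma count_odd_iota a m : count odd (iota a.*2 m.*2.+1) = m.
Proof.
elim: m a => [|m IH] a; first by rewrite /= odd_double.
by move: (IH a.+1); rewrite !doubleS /= !odd_double /= => ->.
Qed.

Section Shape.
Variable n : nat.
Implicit Types (s t u : square n) (d : {set square n}) (D : {set {set square n}}).

(** A square at an odd abscissa is never the end of a tile of positive size, so it
    is either a tile by itself or lies in a tile together with both neighbours. *)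
Definition joined D s : bool := odd (cx s) && (pblock D s != [set s]).

Definition has_heights D (h : 'I_n -> nat) : Prop :=
  forall s, odd (cx s) -> joined D s = (level s < h (column s)).

Section Tiling.
Variable D : {set {set square n}}.
Hypothesis DD : dyck_tiling D.

Let partD : partition D [set: square n]. Proof. by case/and3P: DD. Qed.
Let tileD d : d \in D -> dyck_tile d.
Proof. by case/and3P: DD => _ /forall_inP + _; apply. Qed.
Let coverD d : d \in D ->
  [exists d' in D, (d' != d) && contains_translate d d'] || translate_below d.
Proof. by case/and3P: DD => _ _ /forall_inP; apply. Qed.

(** By induction on the level: the translates of the squares of d lie in one lower
    tile, unless d lies on lambda_b itself. *)
Lemma tile_level d s t : d \in D -> s \in d -> t \in d -> level s = level t.
Proof.
have [m] := ubnP (level s); elim: m => // m IH in d s t *.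
rewrite ltnS => sm dD sd td; have /orP[|] := coverD dD; last first.
  move/forall_inP=> b; have := b s sd; have := b t td; rewrite !cyE; lia.
case/exists_inP=> d' d'D /andP[_ /forall_inP tr].
have /exists_inP[s' s'd] := tr s sd; have /exists_inP[t' t'd] := tr t td.
rewrite !cyE => /andP[/eqP-> e1] /andP[/eqP-> e2].
have le : level s' = level t' by apply: (IH d') => //; clear -sm e2; lia.
by clear -le e1 e2; lia.
Qed.

(** On a fixed level the squares at odd abscissas are the higher ones. A Dyck path
    starting at a higher one cannot go on, as its next center would be below its
    starting height; one starting at a lower one must also end at a lower one. *)
Lemma tile_shape d : d \in D ->
  (exists2 s, odd (cx s) & d = [set s]) \/
  (exists r a b, [/\ a <= b, b + r < n & zigzag r a b d]).
Proof.
move=> dD; have /andP[_] := tileD dD.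
have memd := mem_squares_of d.
have rowd := @tile_level d _ _ dD.
case E: (squares_of d) memd => [|s p] //= memd /and3P[hp /eqP cl lo].
have sd : s \in d by rewrite -memd mem_head.
have cxp := dyck_path_cx hp.
have [os|es] := boolP (odd (cx s)); [left | right].
- exists s => //; case: p => [|t p] in E memd hp lo {cl cxp} *.
    by apply/setP=> x; rewrite -memd !inE.
  have td : t \in d by rewrite -memd inE mem_head orbT.
  move: hp lo => /= /andP[/andP[/eqP e _] _] /andP[].
  by rewrite !cyE (rowd t s) // e; lia.
have ll : level (last s p) = level s by apply: rowd; rewrite // -memd mem_last.
have el : ~~ odd (cx (last s p)) by move: cl; rewrite !cyE ll; lia.
have lE : cx (last s p) = cx s + size p.
  by rewrite -last_map; case: cxp => ->; rewrite last_iota.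
exists (level s), (cx s)./2, (cx s + size p)./2; split; first by lia.
  by have := square_bound (last s p); rewrite lE ll; lia.
move=> t; apply/idP/idP => [td|/andP[/eqP rt ct]].
  have : cx t \in map (@cx n) (s :: p) by apply: map_f; rewrite memd.
  by rewrite cxp mem_iota (rowd t s) //; lia.
have : cx t \in map (@cx n) (s :: p) by rewrite cxp mem_iota; lia.
case/mapP=> u; rewrite memd => ud cu.
by rewrite (square_inj cu) // rt (rowd s u).
Qed.

Lemma pblockD s : pblock D s \in D.
Proof. by rewrite pblock_mem // (cover_partition partD) inE. Qed.

Lemma mem_pblockD s : s \in pblock D s.
Proof. by rewrite mem_pblock (cover_partition partD) inE. Qed.

Lemma pblock_tile d s : d \in D -> s \in d -> pblock D s = d.
Proof. by move=> dD sd; apply: def_pblock => //; case/and3P: partD. Qed.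

Lemma zigzag_joined r a b d s :
  d \in D -> zigzag r a b d -> a <= b -> b + r < n -> s \in d ->
  joined D s = odd (cx s).
Proof.
move=> dD zd ab bn sd; rewrite /joined (pblock_tile dD sd).
case: (boolP (odd (cx s))) => //= os; apply/eqP => dE.
have [t [ct rt]] : exists t : square n, cx t = a.*2 /\ level t = r.
  by apply: square_exists; lia.
have : t \in d by rewrite zd ct rt; lia.
by rewrite {1}dE inE => /eqP E; move: os; rewrite -E ct; lia.
Qed.

(** If t is joined, its tile has at least three squares, and so has the tile just
    below that contains its translate. *)
Lemma joined_down s t : cx s = cx t -> level s <= level t -> joined D t -> joined D s.
Proof.
have [m] := ubnP (level t); elim: m => // m IH in t *.
rewrite ltnS => tm cst; rewrite leq_eqVlt => /orP[/eqP rst|lt].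
  by rewrite (square_inj cst rst).
move=> jt; have /andP[ot nt] := jt.
have [t' [ct' rt']] : exists t' : square n, cx t' = cx t /\ level t' = (level t).-1.
  by apply: square_exists; have := square_bound t; lia.
apply: (IH t'); try lia.
have /orP[|] := coverD (pblockD t); last first.
  by move/forall_inP/(_ t (mem_pblockD t)); rewrite cyE; lia.
case/exists_inP=> d' d'D /andP[_ /forall_inP tr].
have [[u ou dE]|[r [a [b [ab bn z]]]]] := tile_shape (pblockD t).
  by case/eqP: nt; have := mem_pblockD t; rewrite dE inE => /eqP->.
have t'd' : t' \in d'.
  have /exists_inP[x xd'] := tr t (mem_pblockD t); rewrite !cyE => xt.
  by rewrite (@square_inj _ t' x) //; lia.
rewrite /joined ct' ot (pblock_tile d'D t'd'); apply/eqP => dE.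
have [v [cv rv]] : exists v : square n, cx v = a.*2 /\ level v = r.
  by apply: square_exists; lia.
have vd : v \in pblock D t by rewrite z cv rv; lia.
have /exists_inP[x] := tr v vd; rewrite dE inE => /eqP->; rewrite ct' cv.
by move/andP=> [/eqP]; lia.
Qed.

(** The joined squares of a column are its lowest ones, so their number is a
    height; it is computed here as the highest joined level plus one. *)
Lemma heights_exist : exists2 h, has_heights D h & forall c : 'I_n, h c <= n.-1 - c.
Proof.
exists (fun c => \max_(s | joined D s && (column s == c)) (level s).+1) => [s os|c].
  apply/idP/idP => [js|].
    by apply: (leq_bigmax_cond (F := fun s => (level s).+1)); rewrite js eqxx.
  case: (pickP (fun t => joined D t && (column t == column s))) => [t jt|none];
    last by rewrite big_pred0.
  have ne : 0 < #|[pred t | joined D t & column t == column s]|.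
    by apply/card_gt0P; exists t; exact: jt.
  have [u /andP[ju /eqP/(congr1 val) /= cu] ->] :=
    @eq_bigmax_cond _ [pred t | joined D t & column t == column s] (fun s =>
      (level s).+1) ne.
  rewrite ltnS => ru; apply: (joined_down _ ru ju).
  by have /andP[ou _] := ju; lia.
apply/bigmax_leqP => s /andP[/andP[os _] /eqP<-] /=.
by have := square_bound s; lia.
Qed.

Lemma even_tile s : ~~ odd (cx s) ->
  exists r a b, [/\ a <= b, b + r < n & zigzag r a b (pblock D s)].
Proof.
move=> es; case: (tile_shape (pblockD s)) => // -[t ot dE].
by have := mem_pblockD s; rewrite dE inE => /eqP E; move: es; rewrite E ot.
Qed.

Section Heights.
Variable h : 'I_n -> nat.
Hypothesis hD : has_heights D h.

(** A tile of size k > 0 has k squares at odd abscissas, all joined, and a tile of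
    size 0 has none that is joined: the weight counts the joined squares, which
    are then sorted by columns. *)
Lemma weight_heights : (forall c : 'I_n, h c <= n.-1 - c) ->
  tiling_weight D = \sum_c h c.
Proof.
move=> hb.
have sizeE d : d \in D -> tile_size d = \sum_(s in d | joined D s) 1.
  move=> dD; have [[s os dE]|[r [a [b [ab bn z]]]]] := tile_shape dD.
    rewrite big_pred0 => [|t]; first by rewrite /tile_size dE cards1.
    rewrite /joined dE inE; apply/negP => /andP[/eqP-> /andP[_]].
    by rewrite (pblock_tile dD) ?dE ?inE ?eqxx.
  transitivity (count (fun s => odd (cx s)) (squares_of d)); last first.
    rewrite /squares_of count_sort -sum1_count big_enum_cond.
    by apply: eq_bigl => s; case: (boolP (s \in d)) => //= sd;
      rewrite (zigzag_joined dD z).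
  rewrite /tile_size -size_squares_of -(size_map (@cx n)) -(count_map (@cx n) odd).
  rewrite (cx_zigzag ab bn z) size_iota.
  by rewrite count_odd_iota /= half_double.
rewrite /tiling_weight (eq_bigr _ sizeE).
rewrite -(set_partition_big_cond (op := addn) D partD) /=.
rewrite (partition_big (@column n) xpredT) //=; apply: eq_bigr => c _.
rewrite sum1_card -(size_iota 0 (h c)).
rewrite cardE -(size_map (@level n)); apply/perm_size/uniq_perm;
  rewrite ?iota_uniq //.
  rewrite map_inj_in_uniq ?enum_uniq // => s t; rewrite !mem_enum.
  move=> /andP[/andP[_ /andP[os _]] /eqP/(congr1 val) /= sc].
  move=> /andP[/andP[_ /andP[ot _]] /eqP/(congr1 val) /= tc].
  by apply: square_inj; lia.
move=> j; rewrite mem_iota add0n /=; apply/mapP/idP => [[s]|jh].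
  rewrite mem_enum => /andP[/andP[_ js] /eqP sc] ->.
  by move: js (js) => /andP[os _]; rewrite hD // sc.
have [s [cs rs]] : exists s : square n, cx s = c.*2.+1 /\ level s = j.
  by apply: square_exists; have := hb c; have := ltn_ord c; lia.
exists s => //; rewrite mem_enum; have cE : column s = c by apply: val_inj => /=; lia.
by rewrite unfold_in cE eqxx inE hD ?cs ?rs ?cE /=; lia.
Qed.
End Heights.
End Tiling.
End Shape.

(** * Trajectories *)

Lemma connect_terminal (T : finType) (e : rel T) x y z :
  (forall a b c, e a b -> e a c -> b = c) ->
  (forall t, ~~ e y t) -> (forall t, ~~ e z t) ->
  connect e x y -> connect e x z -> y = z.
Proof.
move=> fe ty tz /connectP[p]; elim: p x => [|a p IH] x /=.
  move=> _ yE /connectP[[|b q] /= pq zE]; first by rewrite zE.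
  by case/andP: pq => xb _; have := ty b; rewrite yE xb.
case/andP=> xa pa yE /connectP[[|b q] /= qp zE].
  by have := tz a; rewrite zE xa.
case/andP: qp => xb qp; apply: (IH a pa yE); apply/connectP; exists q.
all: by rewrite (fe _ _ _ xa xb).
Qed.

Section Trajectories.
Variable n : nat.
Implicit Types (s t u : square n) (d : {set square n}) (D : {set {set square n}}).

Section Tiling.
Variable D : {set {set square n}}.
Hypothesis DD : dyck_tiling D.
Variable h : 'I_n -> nat.
Hypothesis hD : has_heights D h.

Lemma joined_pblock u t : joined D u ->
  (cx t).+1 = cx u \/ cx t = (cx u).+1 -> level t = level u ->
  pblock D t = pblock D u.
Proof.
move=> /andP[ou nu] ct lt.
case: (tile_shape DD (pblockD DD u)) => [[v ov dE]|[r [a [b [ab bn z]]]]].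
  by case/eqP: nu; have := mem_pblockD DD u; rewrite dE inE => /eqP->.
apply: (pblock_tile DD) (pblockD DD u) _.
by have := mem_pblockD DD u; rewrite !z; lia.
Qed.

Lemma entry_even s : ~~ odd (cx s) ->
  (forall u, (cx u).+1 = cx s -> level u = level s -> ~~ joined D u) ->
  entry (pblock D s) = nw_edge s.
Proof.
move=> es nj; have [r [a [b [ab bn z]]]] := even_tile DD es.
have [t [p [E ct _]]] := squares_of_zigzag ab bn z.
rewrite /entry E; congr (nw_edge _).
have sd := mem_pblockD DD s; have : t \in pblock D s by rewrite -mem_squares_of E
  mem_head.
rewrite z => td; move: (sd); rewrite z => sz.
apply: square_inj; last by lia.
apply/eqP; apply: contraT => ne.
have [u [cu ru]] : exists u : square n, cx u = (cx s).-1 /\ level u = r.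
  by apply: square_exists; lia.
have ud : u \in pblock D s by rewrite z; lia.
have := nj u; rewrite (zigzag_joined DD (pblockD DD s) z) //; lia.
Qed.

(** The next square of the level of s, if there is one, is in the same column and so
    is not joined. *)
Lemma exit_even s : ~~ odd (cx s) -> h (column s) <= level s ->
  exit (pblock D s) = se_edge s.
Proof.
move=> es nj; have [r [a [b [ab bn z]]]] := even_tile DD es.
have [t [p [E _ ct]]] := squares_of_zigzag ab bn z.
rewrite /exit E; congr (se_edge _).
have sd := mem_pblockD DD s; have : last t p \in pblock D s by rewrite
  -mem_squares_of E mem_last.
rewrite z => td; move: (sd); rewrite z => sz.
apply: square_inj; last by lia.
apply/eqP; apply: contraT => ne.
have [u [cu ru]] : exists u : square n, cx u = (cx s).+1 /\ level u = r.
  by apply: square_exists; lia.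
have ud : u \in pblock D s by rewrite z; lia.
have := zigzag_joined DD (pblockD DD s) z ab bn ud.
have cE : column u = column s by apply: val_inj => /=; lia.
by rewrite hD ?cE; lia.
Qed.

Lemma odd_unjoined u : odd (cx u) -> ~~ joined D u ->
  [/\ pblock D u = [set u], entry (pblock D u) = nw_edge u &
      exit (pblock D u) = se_edge u].
Proof.
move=> ou; rewrite /joined ou /= negbK => /eqP->.
by rewrite /entry /exit squares_of1.
Qed.

Lemma level_pblock s t : t \in pblock D s -> level t = level s.
Proof. by move=> td; apply: (tile_level DD) (pblockD DD s) _ _;
  rewrite ?mem_pblockD. Qed.

(** The value r(c) is the level on which the trajectory of the anchor box i reaches
    the abscissa 2c. Going down a level in the column c uses the square at abscissa
    2c + 1 on level r(c) - 1, which is a tile by itself if h(c) < r(c); when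
    h(c) = r(c) this square is joined, and the trajectory hits its tile from
    above. *)
Lemma trajectory (i k : 'I_n) (r : nat -> nat) :
  (forall c : 'I_n, h c <= n.-1 - c) ->
  r 0 = n.-1 - i ->
  (forall c : 'I_n, c < k ->
     if r c < h c then r c.+1 = r c else h c < r c /\ r c.+1 = (r c).-1) ->
  r k = h k -> label_at D i k.
Proof.
move=> hb r0 step rk.
have [s0 [c0 l0]] : exists s : square n, cx s = 0 /\ level s = r 0.
  by apply: square_exists; have := ltn_ord i; lia.
have reach c : c <= k -> exists s, [/\ cx s = c.*2, level s = r c &
    connect (continues D) (pblock D s0) (pblock D s)].
  elim: c => [|c IH] ck; first by exists s0.
  have [s [cs ls con]] := IH (ltnW ck).
  have cn : c < n by have := ltn_ord k; lia.
  have sb := square_bound s.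
  have := step (Ordinal cn) ck; have := hb (Ordinal cn) => /=.
  set hc := h _ => hcb.
  have hcol u : (cx u)./2 = c -> h (column u) = hc by move=> cu; congr h;
    exact: val_inj.
  case: ltnP => [lt rE|le [lt rE]].
    (* u joins s to the square t at the next even abscissa of the same level *)
    have [u [cu lu]] : exists u : square n, cx u = c.*2.+1 /\ level u = r c.
      by apply: square_exists; lia.
    have [t [ct lt']] : exists t : square n, cx t = c.+1.*2 /\ level t = r c.
      by apply: square_exists; lia.
    have ju : joined D u by rewrite hD ?hcol; lia.
    exists t; split; [by [] | by rewrite rE | rewrite (joined_pblock (t := t) ju);
      try lia].
    by rewrite -(joined_pblock (t := s) ju) //; lia.
  (* the trajectory leaves s through the single square u and enters t *)
  have [u [cu lu]] : exists u : square n, cx u = c.*2.+1 /\ level u = (r c).-1.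
    by apply: square_exists; lia.
  have [t [ct lt']] : exists t : square n, cx t = c.+1.*2 /\ level t = (r c).-1.
    by apply: square_exists; lia.
  have ju : ~~ joined D u by rewrite hD ?hcol; lia.
  have [uE uentry uexit] := odd_unjoined (u := u) ltac:(lia) ju.
  exists t; split; [by [] | by rewrite rE | ].
  have xE : exit (pblock D s) = nw_edge u.
    by rewrite exit_even ?hcol; try lia; rewrite /nw_edge /se_edge !cyE;
      congr (_, _); lia.
  have eE : entry (pblock D t) = se_edge u.
    rewrite entry_even; first by rewrite /nw_edge /se_edge !cyE; congr (_, _); lia.
      lia.
    by move=> v cv lv; rewrite (@square_inj _ v u) //; lia.
  have su : continues D (pblock D s) (pblock D u).
    rewrite /continues /= !(pblockD DD) xE uentry eqxx andbT /= uE.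
    apply: contraTneq (mem_pblockD DD s) => <-; rewrite inE.
    by apply/eqP=> E; move: cs; rewrite E; lia.
  have ut : continues D (pblock D u) (pblock D t).
    rewrite /continues /= !(pblockD DD) uexit eE eqxx andbT /= uE.
    apply: contraTneq (mem_pblockD DD t) => ->; rewrite inE.
    by apply/eqP=> E; move: ct; rewrite E; lia.
  exact: connect_trans con (connect_trans (connect1 su) (connect1 ut)).
have [s [cs ls con]] := reach k (leqnn k).
have ck : column s = k by apply: val_inj => /=; lia.
have xE : exit (pblock D s) = se_edge s by apply: exit_even; rewrite ?ck; lia.
apply/exists_inP; exists (pblock D s0); rewrite ?pblockD //; apply/andP; split.
  apply/exists_inP; exists s0; rewrite ?mem_pblockD // /is_anchor c0 cyE c0 l0 r0.
  by have := ltn_ord i; lia.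
apply/exists_inP; exists (pblock D s); rewrite ?pblockD // con /=.
(* on level 0 the exit is the up step of lambda_b; otherwise it bounds the tile
   of the joined square u just below it *)
rewrite /ends_at xE; case: (posnP (r k)) => rk0.
  by apply/orP; left; rewrite /se_edge /peak cyE; apply/eqP; congr (_, _); lia.
apply/orP; right; rewrite /= cs eqxx andbT.
have [u [cu lu]] : exists u : square n, cx u = k.*2.+1 /\ level u = (r k).-1.
  by apply: square_exists; have := square_bound s; lia.
have cuE : column u = k by apply: val_inj => /=; lia.
have ju : joined D u by rewrite hD ?cuE; lia.
have ud := mem_pblockD DD u.
apply/exists_inP; exists (pblock D u); rewrite ?pblockD //; apply/and3P; split.
- by apply: contraTneq ud => ->; apply/negP => /level_pblock; lia.
- rewrite /boundary_up_step.
  have -> : [exists t in pblock D u, nw_edge t == se_edge s].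
    by apply/exists_inP; exists u => //; rewrite /nw_edge /se_edge !cyE; apply/eqP;
      congr (_, _); lia.
  rewrite addTb; apply/exists_inP => -[t td /eqP[ct yt]].
  by move: yt; rewrite !cyE ct (level_pblock td); lia.
case: (tile_shape DD (pblockD DD u)) => [[v ov dE]|[r' [a [b [ab bn z]]]]].
  by move: ju ud; rewrite /joined dE inE => /andP[_] + /eqP E; rewrite E eqxx.
have [t [p [E ct _]]] := squares_of_zigzag ab bn z.
by rewrite /entry E /nw_edge /se_edge ct cs; apply/eqP => -[]; lia.
Qed.
End Tiling.

Section Unique.
Variable D : {set {set square n}}.
Hypothesis partD : partition D [set: square n].

Let meetD d d' s : d \in D -> d' \in D -> s \in d -> s \in d' -> d = d'.
Proof.
case/and3P: partD => _ tD _ dD d'D sd sd'.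
by rewrite -(def_pblock tD dD sd) -(def_pblock tD d'D sd').
Qed.

Let first_last d : d \in D -> exists s t,
  [/\ s \in d, t \in d, entry d = nw_edge s & exit d = se_edge t].
Proof.
case/and3P: partD => _ _ n0 dD; have [x xd] : exists x, x \in d.
  by apply/set0Pn; apply: contraNneq n0 => <-.
move: xd; rewrite -mem_squares_of /entry /exit.
case E: (squares_of d) => [|s p] // _; exists s, (last s p).
by rewrite -!mem_squares_of E mem_head mem_last.
Qed.

Lemma nw_edge_inj : injective (@nw_edge n).
Proof. by move=> s t [e1 e2]; apply: square_inj => //; rewrite /level e2. Qed.
Lemma se_edge_inj : injective (@se_edge n).
Proof. by move=> s t [e1 e2]; apply: square_inj => //; rewrite /level e2. Qed.

Lemma continues_functional d d1 d2 : continues D d d1 -> continues D d d2 -> d1 = d2.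
Proof.
move=> /and4P[_ d1D _ /eqP e1] /and4P[_ d2D _ /eqP e2].
have [s1 [_ [s1d _ E1 _]]] := first_last d1D.
have [s2 [_ [s2d _ E2 _]]] := first_last d2D.
by apply: (meetD d1D d2D s1d); rewrite (@nw_edge_inj s1 s2) // -E1 -E2 -e1 -e2.
Qed.

(** An up edge is the north-west side of at most one square and the south-east side
    of at most one square. If the exit of d were the entry of another tile, these
    two squares would lie in d and in that tile, and the edge could bound no third
    tile. *)
Lemma ends_at_terminal d d' k : ends_at D d k -> ~~ continues D d d'.
Proof.
move=> e; apply/negP => /and4P[dD d'D nd /eqP xE].
have [s' [_ [s'd _ E1 _]]] := first_last d'D.
have [_ [t [_ td _ E2]]] := first_last dD.
case/orP: e => [/eqP|/andP[/exists_inP[d2 d2D /and3P[nd2 bd ne]] _]].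
  by rewrite xE E1 => -[_]; rewrite cyE; lia.
move: bd; rewrite /boundary_up_step.
case: exists_inP => [[u ud /eqP]|_].
  rewrite xE E1 => /nw_edge_inj uE; case/eqP: ne; rewrite xE; congr entry.
  by apply: (meetD d'D d2D s'd); rewrite -uE.
case: exists_inP => // -[u ud /eqP]; rewrite E2 => /se_edge_inj uE.
by case/eqP: nd2; apply: (meetD d2D dD ud); rewrite uE.
Qed.

Lemma ends_at_inj d k k' : ends_at D d k -> ends_at D d k' -> k = k'.
Proof.
have ex j : ends_at D d j -> (exit d).1 = j.*2.+1.
  by case/orP => [/eqP->|/andP[_ /eqP->]].
by move=> /ex e1 /ex; rewrite e1 => e; apply: val_inj => /=; lia.
Qed.

(** The trajectories are deterministic, hence a label is written below at most one
    peak. *)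
Lemma label_at_inj i k k' : label_at D i k -> label_at D i k' -> k = k'.
Proof.
case/exists_inP=> d0 d0D /andP[/exists_inP[s sd sa] /exists_inP[d dD /andP[con e]]].
case/exists_inP=> d0' d0'D /andP[/exists_inP[s' s'd sa'] /exists_inP[d' d'D
  /andP[con' e']]].
have ss : s = s'.
  move: sa sa' => /andP[/eqP a1 /eqP a2] /andP[/eqP b1 /eqP b2].
  by apply: square_inj; rewrite ?a1 // /level a2 b2.
have dd : d0 = d0' by apply: (meetD d0D d0'D sd); rewrite ss.
suff : d = d' by move=> E; move: e' ; rewrite -E; exact: ends_at_inj.
rewrite -dd in con'; apply: connect_terminal con con'.
- exact: continues_functional.
- by move=> x; exact: ends_at_terminal e.
- by move=> x; exact: ends_at_terminal e'.
Qed.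

Lemma has_permutation_inj (w w' : 'S_n) :
  has_permutation D w -> has_permutation D w' -> w = w'.
Proof.
move=> /forallP H /forallP H'; apply/permP => j.
have := H j; have := H' ((w'^-1)%g (w j)); rewrite permKV => l1 l2.
by have /rev_ord_inj e := label_at_inj l2 l1; rewrite {2}e permKV.
Qed.
End Unique.
End Trajectories.

(** * The tiling with given heights *)

Section Build.
Variable n : nat.
Implicit Types (s t u : square n) (d : {set square n}).

Lemma zigzag_dyck_tile r a b d : a <= b -> b + r < n -> zigzag r a b d -> dyck_tile d.
Proof.
move=> ab bn z; suff dp : dyck_path (squares_of d) by rewrite /dyck_tile
  dyck_path_ribbon.
have := cx_zigzag ab bn z; have [s [p [E cs cl]]] := squares_of_zigzag ab bn z.
have lev t : t \in s :: p -> level t = r by rewrite -E mem_squares_of z =>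
  /andP[/eqP].
rewrite E /= => -[_ cp]; apply/and3P; split.
- elim: p s (b - a).*2 a.*2 cs cp lev {E ab z cl} =>
  //= t p IH s [|m] x //= cs [ct cp] lev.
  apply/andP; split; last by apply: IH ct cp _ => v vp; apply: lev;
    rewrite inE vp orbT.
  by rewrite /dyck_step !cyE ct cs !lev ?inE ?eqxx ?orbT //=; lia.
- by rewrite !cyE cs cl !lev ?mem_head ?mem_last // !odd_double.
by apply/allP => t tp; rewrite !cyE cs !lev ?mem_head ?inE ?tp ?orbT // odd_double;
  lia.
Qed.

Variable h : 'I_n -> nat.

(** On level r, two even abscissas lie in the same tile when no column between them
    has its square on level r split off; they then have the same number of such
    columns on their left. *)
Definition breaks (r i : nat) : nat := #|[set c : 'I_n | (c < i) && (h c <= r)]|.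

(** The right-hand side gets weaker when r decreases, so squares joined on one level
    are also joined on the lower ones: this is how cover-inclusiveness enters. *)
Lemma breaks_eq r i i' : i <= i' ->
  (breaks r i == breaks r i') = [forall c : 'I_n, (i <= c < i') ==> (r < h c)].
Proof.
move=> ii; have sub : [set c : 'I_n | (c < i) && (h c <= r)]
    \subset [set c : 'I_n | (c < i') && (h c <= r)].
  by apply/subsetP => c; rewrite !inE; lia.
rewrite /breaks (subset_leqif_card sub); apply/subsetP/forallP => H c.
  by apply/implyP => ci; have := H c; rewrite !inE; lia.
by have := H c; rewrite !inE => /implyP; lia.
Qed.

Lemma leq_breaks r i i' : i <= i' -> breaks r i <= breaks r i'.
Proof. by move=> ii; apply/subset_leq_card/subsetP => c; rewrite !inE; lia. Qed.

Lemma breaksS r (c : 'I_n) : (breaks r c == breaks r c.+1) = (r < h c).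
Proof.
rewrite breaks_eq //; apply/forallP/idP => [/(_ c)/implyP-> //|rc c'];
  first by rewrite leqnn ltnSn.
by apply/implyP; rewrite ltnS -eqn_leq => /eqP/val_inj <-.
Qed.

Definition split_off s : bool := odd (cx s) && (h (column s) <= level s).

(** The tiles of the tiling to be built are the classes of squares with equal keys:
    a square split off is alone in its class, any other square is grouped with those
    of its level not separated from it by a break. *)
Definition tile_key s : square n + nat * nat :=
  if split_off s then inl s else inr (level s, breaks (level s) (cx s)./2).

Definition tiling_of_heights : {set {set square n}} :=
  preim_partition tile_key [set: square n].

Local Notation D := tiling_of_heights.

Lemma mem_tile s t : (t \in pblock D s) = (tile_key s == tile_key t).
Proof.
rewrite pblock_equivalence_partition ?inE // => x y z _ _ _ /=.
by split=> // /eqP->.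
Qed.

Lemma tile_split_off s : split_off s -> pblock D s = [set s].
Proof.
move=> so; apply/setP => t; rewrite mem_tile inE /tile_key so.
case: ifP => [_|nt]; first by rewrite (inj_eq (@inl_inj _ _)) eq_sym.
by apply/esym/negbTE; apply: contraFneq nt => ->.
Qed.

(** The number of breaks is a nondecreasing function of the column, so the columns
    where it takes a given value form an interval [a, b]; a square at an odd
    abscissa belongs to the tile when it lies strictly between 2a and 2b. *)
Lemma tile_zigzag s : ~~ split_off s -> exists a b,
  [/\ a <= b, b + level s < n & zigzag (level s) a b (pblock D s)].
Proof.
move=> ns; set r := level s; set i := (cx s)./2.
pose P j := (j + r < n) && (breaks r j == breaks r i).
have Pi : P i by rewrite /P eqxx andbT /i /r; have := square_bound s; lia.
have exP : exists j, P j by exists i.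
have leP j : P j -> j <= n by case/andP; lia.
case: (ex_minnP exP) => a Pa mina; case: (ex_maxnP exP leP) => b Pb maxb.
have convex j : (a <= j <= b) = P j.
  apply/idP/idP => [/andP[aj jb]|Pj]; last by rewrite mina ?maxb.
  have /andP[_ /eqP ea] := Pa; have /andP[bn /eqP eb] := Pb.
  apply/andP; split; first by lia.
  by rewrite eqn_leq -{1}eb -ea !leq_breaks.
exists a, b; split; [by rewrite (leq_trans (mina _ Pi)) ?maxb | by case/andP: Pb|].
move=> t; rewrite mem_tile /tile_key (negbTE ns) -/r -/i.
have [lt|nlt] := eqVneq (level t) r; last first.
  case: ifP => // _; rewrite (inj_eq (@inr_inj _ _)) xpair_eqE.
  by rewrite [r == _]eq_sym (negbTE nlt).
rewrite lt /= /split_off lt; have tb := square_bound t; rewrite lt in tb.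
case: (boolP (odd (cx t))) => [ot|et] /=; last first.
  rewrite (inj_eq (@inr_inj _ _)) xpair_eqE eqxx /=.
  have -> : (a.*2 <= cx t <= b.*2) = (a <= (cx t)./2 <= b) by lia.
  by rewrite convex /P eq_sym; lia.
have -> : (a.*2 <= cx t <= b.*2) = (a <= (cx t)./2 <= b) && (a <= (cx t)./2.+1 <=
  b) by lia.
rewrite !convex /P -[(cx t)./2]/(val (column t)).
have bS := breaksS r (column t).
case: (leqP (h (column t)) r) => hc.
  apply/idP/idP => // /andP[/andP[_ /eqP e1] /andP[_ /eqP e2]].
  by move: bS; rewrite e1 e2 eqxx ltnNge hc.
move: bS; rewrite hc => /eqP <-; rewrite (inj_eq (@inr_inj _ _)) xpair_eqE eqxx /=.
by rewrite [breaks r i == _]eq_sym; lia.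
Qed.

Lemma part_heights : partition D [set: square n].
Proof. exact: preim_partitionP. Qed.

Lemma tile_heightsP d : d \in D -> exists2 s, s \in d & d = pblock D s.
Proof.
case/and3P: part_heights => _ tD n0 dD.
have /set0Pn[s sd] : d != set0 by apply: contraNneq n0 => <-.
by exists s; rewrite // (def_pblock tD dD sd).
Qed.

Let pblock_in s : pblock D s \in D.
Proof. by rewrite pblock_mem // (cover_partition part_heights) inE. Qed.
Let mem_pb s : s \in pblock D s.
Proof. by rewrite mem_pblock (cover_partition part_heights) inE. Qed.

Lemma dyck_tiling_heights : dyck_tiling D.
Proof.
rewrite /dyck_tiling part_heights /=; apply/andP; split.
  apply/forall_inP => d /tile_heightsP[s sd ->].
  have [so|ns] := boolP (split_off s).
    rewrite tile_split_off // /dyck_tile dyck_path_ribbon squares_of1 //=;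
    by rewrite eqxx.
  by have [a [b [ab bn z]]] := tile_zigzag ns; exact: zigzag_dyck_tile z.
apply/forall_inP => d /tile_heightsP[s sd dE].
have lev t : t \in d -> level t = level s.
  rewrite dE; have [so|ns] := boolP (split_off s).
    by rewrite tile_split_off // inE => /eqP->.
  by have [a [b [ab bn z]]] := tile_zigzag ns; rewrite z => /andP[/eqP].
have [l0|lp] := posnP (level s); apply/orP; [right|left].
  by apply/forall_inP => t /lev lt; rewrite cyE lt l0; lia.
have down t : t \in d -> exists u : square n, cx u = cx t /\ level u = (level s).-1.
  by move=> td; apply: square_exists; have := square_bound t; rewrite (lev t td); lia.
have [s' [cs' ls']] := down s sd.
apply/exists_inP; exists (pblock D s'); first exact: pblock_in.
apply/andP; split.
  by apply: contraTneq (mem_pb s') => ->; apply/negP => /lev; lia.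
apply/forall_inP => t td; have [u [cu lu]] := down t td.
apply/exists_inP; exists u; last by rewrite cu !cyE cu lu lev // eqxx /=; lia.
rewrite mem_tile; move: td; rewrite dE.
have [so|ns] := boolP (split_off s).
  rewrite tile_split_off // inE => /eqP ts.
  by rewrite (@square_inj _ u s') // ?cu ?ts // lu ls'.
rewrite mem_tile => /eqP; rewrite /tile_key (negbTE ns);
  case: ifP => // nt [/esym lt e].
(* a square that is not split off has the same property one level down *)
have below v v' : cx v' = cx v -> level v = level s -> level v' = (level s).-1 ->
  split_off v = false -> split_off v' = false.
  rewrite /split_off => cv lv lv';
    have -> : column v' = column v by apply: val_inj; rewrite /= cv.
  by rewrite cv lv lv'; lia.
rewrite (below s s') ?(negbTE ns) // (below t u) // ls' lu cs' cu.
rewrite (inj_eq (@inr_inj _ _)) xpair_eqE eqxx /=.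
rewrite lt in e.
have mono i j : i <= j -> breaks (level s) i == breaks (level s) j ->
  breaks (level s).-1 i == breaks (level s).-1 j.
  move=> ij; rewrite !breaks_eq // => /forallP H; apply/forallP => c.
  by apply/implyP => ic; have := H c; rewrite ic /=; lia.
case: (leqP (cx s)./2 (cx t)./2) => [le|/ltnW le]; first by apply: mono le _;
  rewrite e.
by rewrite eq_sym; apply: mono le _; rewrite e.
Qed.

Lemma has_heights_tiling : has_heights D h.
Proof.
move=> s os; rewrite ltnNge.
have [so|ns] := boolP (split_off s).
  by rewrite /joined tile_split_off // eqxx andbF; move: so;
    rewrite /split_off os /= => ->.
have [a [b [ab bn z]]] := tile_zigzag ns.
rewrite (zigzag_joined dyck_tiling_heights (pblock_in s) z) // os.
by move: ns; rewrite /split_off os /= => ->.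
Qed.
End Build.

(** * Codes of permutations *)

Section Codes.
Variable n : nat.
Implicit Types (w : 'S_n) (l m : 'I_n).

Definition prefix_rank w (p : nat) l : nat :=
  #|[set k : 'I_n | (k < p) && (w k < w l)]|.
(** The left code of w: m minus this number is the number of inversions of w that
    end at m. *)
Definition code w m : nat := prefix_rank w m m.

Lemma perm_neq w l m : l != m -> w l != w m :> nat.
Proof. by apply: contra => /eqP/val_inj/perm_inj->. Qed.

Lemma card_lt_ord (p : nat) : p <= n -> #|[set k : 'I_n | k < p]| = p.
Proof.
move=> pn; rewrite -sum1_card -[RHS]card_ord -[RHS]sum1_card (big_ord_widen n
  (fun=> 1) pn).
by apply: eq_bigl => k; rewrite inE.
Qed.

Lemma prefix_rankS w m l : prefix_rank w m.+1 l = prefix_rank w m l + (w m < w l).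
Proof.
rewrite /prefix_rank (cardsD1 m) !inE ltnSn /= addnC; congr (_ + _).
by apply: eq_card => k; rewrite !inE ltnS leq_eqVlt -val_eqE /=; case: ltngtP;
  rewrite ?andbF.
Qed.

Lemma ltn_prefix_rank w (p : nat) l : p <= n -> l < p -> prefix_rank w p l < p.
Proof.
move=> pn lp; rewrite -[X in _ < X](card_lt_ord pn); apply: proper_card.
apply/properP; split; first by apply/subsetP => k; rewrite !inE => /andP[].
by exists l; rewrite !inE ?lp // ltnn andbF.
Qed.

Lemma prefix_rank_full w l : prefix_rank w n l = w l.
Proof.
have wn : w l <= n by exact: ltnW.
rewrite -[RHS](card_lt_ord wn) -[RHS](card_preimset _ (@perm_inj _ w)).
by apply: eq_card => k; rewrite !inE ltn_ord.
Qed.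

Lemma code_leq w m : code w m <= m.
Proof.
rewrite -[X in _ <= X](card_lt_ord (ltnW (ltn_ord m))).
by apply/subset_leq_card/subsetP => k; rewrite !inE => /andP[].
Qed.

(** Inserting w(m) shifts the rank of w(l) by one exactly when w(m) < w(l), and the
    code alone decides this. This is both the induction step of the decoding of w
    and the alternative met by a trajectory in a column. *)
Lemma code_prefix_rank w m l : l < m -> (code w m <= prefix_rank w m l) = (w m < w l).
Proof.
move=> lm; apply/idP/idP => [|lt]; last first.
  by apply/subset_leq_card/subsetP => k; rewrite !inE; lia.
apply: contraLR; rewrite -leqNgt -ltnNge leq_eqVlt (negbTE (perm_neq _ _)) ?neq_ltn
  ?lm //= => lt.
apply: proper_card; apply/properP; split; first by apply/subsetP => k;
  rewrite !inE; lia.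
by exists l; rewrite !inE ?lm ?lt ?ltnn.
Qed.

(** The code determines the ranks in all prefixes, by induction on their length, and
    the ranks in the full word are the values of w. *)
Lemma code_inj w w' : code w =1 code w' -> w = w'.
Proof.
move=> cE; suff rk p : p <= n -> forall l, l < p ->
  prefix_rank w p l = prefix_rank w' p l.
  by apply/permP => l; apply: val_inj; rewrite /= -!prefix_rank_full rk.
elim: p => // p IH pn l; rewrite ltnS => lp.
rewrite -[p]/(val (Ordinal pn)) !prefix_rankS /=.
move: lp; rewrite leq_eqVlt => /orP[/eqP e|lp].
  have {e} -> : l = Ordinal pn by apply: val_inj.
  by rewrite !ltnn !addn0; exact: cE.
have := IH (ltnW pn) l lp; rewrite -!(@code_prefix_rank _ (Ordinal pn) l) // cE /=
  => ->.
by [].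
Qed.

(** There are n! sequences with a(m) <= m, as many as permutations, and the code is
    injective. *)
Lemma code_surj (a : 'I_n -> nat) : (forall m, a m <= m) -> exists w, code w =1 a.
Proof.
move=> am.
pose f w : {dffun forall m : 'I_n, 'I_m.+1} := [ffun m => inord (code w m)].
have f_inj : injective f.
  move=> w w' /ffunP E; apply: code_inj => m; have := E m;
    rewrite !ffunE => /(congr1 val).
  by rewrite /= !inordK // ltnS code_leq.
have [|g _ fK] := inj_card_bij f_inj.
  rewrite card_dep_ffun card_Sn.
  rewrite foldrE big_map big_enum /= fact_prod big_add1 big_mkord.
  by apply: eq_leq; apply: eq_bigr => m _; rewrite card_ord.
exists (g [ffun m => inord (a m)]) => m.
have /ffunP/(_ m) := fK [ffun m => inord (a m)]; rewrite !ffunE => /(congr1 val).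
by rewrite /= !inordK // ltnS ?code_leq ?am.
Qed.

(** The code can only decrease at a descent w(m) > w(m + 1), and does so when some
    earlier value lies between them, that is when m and m + 1 are the last two
    positions of a pattern 231. Any pattern at i < j < k produces one of this kind:
    between j and k the word passes from above w(i) to below it in one step. *)
Lemma avoids231_code w :
  avoids231 w = [forall m : 'I_n, forall m' : 'I_n,
    (m' == m.+1 :> nat) ==> (code w m <= code w m')].
Proof.
apply/idP/idP => [av|/forallP mono].
  apply/forallP => m; apply/forallP => m'; apply/implyP => /eqP mm'.
  rewrite {2}/code mm' prefix_rankS.
  have [lt|le] := ltnP (w m) (w m').
    rewrite (leq_trans _ (leq_addr _ _)) //; apply/subset_leq_card/subsetP => k.
    by rewrite !inE; lia.
  rewrite addn0; apply/subset_leq_card/subsetP => k; rewrite !inE => /andP[km kw].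
  rewrite km /= ltnNge; apply: contra av => le'; apply/existsP; exists k;
    apply/existsP; exists m.
  apply/existsP; exists m'; rewrite km kw mm' ltnSn ltn_neqAle le' andbT /= andbT.
  by apply: perm_neq; rewrite -val_eqE /= mm'; lia.
apply/negP => /existsP[i /existsP[j /existsP[k /and4P[ij jk ki wij]]]].
pose P p := (j < p) && [exists m : 'I_n, (m == p :> nat) && (w m < w i)].
have exP : exists p, P p by exists k; rewrite /P jk; apply/existsP; exists k;
  rewrite eqxx.
(* p is the first position after j with a value below w i *)
case: (ex_minnP exP) => p /andP[jp /existsP[m /andP[/eqP mp mi]]] minp.
have pn : p.-1 < n by have := ltn_ord m; lia.
pose m0 : 'I_n := Ordinal pn.
have im0 : i < m0 by rewrite /=; lia.
have wm0 : w i < w m0.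
  have ne : w i != w m0 :> nat by apply: perm_neq; rewrite -val_eqE /=; lia.
  rewrite ltn_neqAle ne leqNgt; apply/negP => lt.
  have jm : j <= m0 by rewrite /=; lia.
  move: jm; rewrite leq_eqVlt => /orP[/eqP/val_inj jE|jm]; first by move: lt;
    rewrite -jE; lia.
  have : P p.-1 by rewrite /P jm; apply/existsP; exists m0; rewrite eqxx lt.
  by move/minp; lia.
have mm0 : m = m0.+1 :> nat by rewrite /= mp; lia.
have /forallP/(_ m) := mono m0; rewrite mm0 eqxx /= leqNgt => /negP; apply.
have wm : (w m0 < w m) = false by lia.
rewrite {1}/code mm0 prefix_rankS wm addn0.
apply: proper_card; apply/properP; split; first by apply/subsetP => l;
  rewrite !inE; lia.
by exists i; rewrite !inE ?im0 ?wm0 //= ltnNge ltnW.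
Qed.

(** The Lehmer code of the word of levels of w read from left to right; the column c
    corresponds to the position n - 1 - c of w, since w is read from right to
    left. *)
Definition height w (c : 'I_n) : nat := rev_ord c - code w (rev_ord c).

Lemma height_bound w c : height w c <= n.-1 - c.
Proof. by rewrite /height /=; lia. Qed.

Lemma heights_of_perm (h : 'I_n -> nat) : (forall c : 'I_n, h c <= n.-1 - c) ->
  exists w, height w =1 h.
Proof.
move=> hb; have [|w cw] := @code_surj (fun m => m - h (rev_ord m));
  first by move=> m; lia.
exists w => c; rewrite /height cw rev_ordK /=; have := hb c; have := ltn_ord c; lia.
Qed.

(** Among the anchor boxes whose trajectories reach the column c, that of w(j) has
    level equal to the number of those with a larger label, which is the number of
    l < n - c with w(l) > w(j). Comparing it with the height is comparing w(j) with
    the label that stops there, by [code_prefix_rank]. *)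
Lemma has_permutation_heights w D : dyck_tiling D -> has_heights D (height w) ->
  has_permutation D w.
Proof.
move=> DD hD; apply/forallP => j.
apply: (trajectory DD hD (r := fun c => n.-1 - c - prefix_rank w (n - c) j)).
- exact: height_bound.
- by rewrite !subn0 prefix_rank_full.
- move=> c ck; pose m := rev_ord c; have cn := ltn_ord c.
  have jm : j < m by move: ck => /=; have := ltn_ord j; lia.
  have -> : n - c = m.+1 by rewrite /=; lia.
  have -> : n - c.+1 = m by [].
  rewrite prefix_rankS -code_prefix_rank // /height -/m.
  have := code_leq w m; have := @ltn_prefix_rank w m j (ltnW (ltn_ord m)) jm.
  have -> : n.-1 - c = m by rewrite /=; lia.
  have -> : n.-1 - c.+1 = m.-1 by rewrite /=; lia.
  by case: (leqP (code w m) _) => ab b cc; case: ltnP => lt; lia.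
rewrite /height rev_ordK /= /code.
have jn := ltn_ord j; have -> : n - (n - j.+1) = j.+1 by lia.
by rewrite prefix_rankS ltnn addn0; congr (_ - _); lia.
Qed.

(** The tiling built from the heights of w has the permutation w, so the choice in
    [tiling_of] succeeds. Whatever tiling D it selects, the heights of D are those of
    some permutation w', which D also has; hence w' = w. *)
Lemma weight_tiling_of w : tiling_weight (tiling_of w) = \sum_(m < n) (m - code w m).
Proof.
have DD := dyck_tiling_heights (height w).
have PD : has_permutation (tiling_of_heights (height w)) w.
  by apply: has_permutation_heights DD _; exact: has_heights_tiling.
rewrite /tiling_of; case: pickP =>
  [D /andP[dD pD]|/(_ (tiling_of_heights (height w)))]; last by rewrite DD PD.
have [h hD hb] := heights_exist dD.
have [w' hw'] := heights_of_perm hb.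
have pD' : has_permutation D w'.
  by apply: has_permutation_heights dD _ => s os; rewrite hw' hD.
have -> : w = w' by apply: has_permutation_inj pD pD'; case/and3P: dD.
rewrite (weight_heights dD hD hb) (reindex_inj rev_ord_inj) /=.
by apply: eq_bigr => c _; rewrite -hw' /height rev_ordK.
Qed.
End Codes.

(** * Weakly increasing codes and the q-Catalan numbers *)

(** Weakly decreasing sequences x(0), ..., x(i-1) with x(k) <= i - 1 - k and with
    entries less than t. They are read backwards with respect to the codes, so that
    the last entry of a code, on which the recursion is based, comes first. *)
Fixpoint staircases (i t : nat) : seq (seq nat) :=
  if i is i'.+1 then
    [seq j :: a | j <- [seq j <- iota 0 t | j <= i'], a <- staircases i' j.+1]
  else [:: [::]].

Lemma staircasesP i t a :
  reflect [/\ size a = i, i > 0 -> nth 0 a 0 < t,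
              forall k, k < i -> nth 0 a k + k < i
            & forall k, k.+1 < i -> nth 0 a k.+1 <= nth 0 a k]
          (a \in staircases i t).
Proof.
elim: i t a => [|i IH] t a; first by rewrite inE; case: a => [|x a];
  constructor => // -[].
apply: (iffP allpairsPdep) => [[j [b [jt /IH[sb b0 bk bs] ->]]]|[]].
  move: jt; rewrite mem_filter mem_iota /= => /andP[ji jt]; split=> //=.
  - by rewrite sb.
  - by case=> [|k] ki; rewrite ?addn0 //= addnS ltnS bk.
  by case=> [|k] ki //=; [rewrite -ltnS b0 | exact: bs].
case: a => // j b [sb] b0 bk bs; exists j, b; split=> //.
  by rewrite mem_filter mem_iota /= b0 // andbT; have := bk 0; rewrite /= addn0;
    apply.
apply/IH; split=> // [i0|k ki|k ki]; first by rewrite ltnS; apply: (bs 0).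
  by have := bk k.+1; rewrite /= addnS !ltnS; apply.
exact: (bs k.+1).
Qed.

Lemma staircases_uniq i t : uniq (staircases i t).
Proof.
elim: i t => //= i IH t; apply: allpairs_uniq_dep => //;
  first by rewrite filter_uniq ?iota_uniq.
by move=> [x a] [y b] _ _ [-> ->].
Qed.

Definition code_seq n (w : 'S_n) : seq nat :=
  [seq code w (rev_ord c) | c <- enum 'I_n].

Lemma size_code_seq n (w : 'S_n) : size (code_seq w) = n.
Proof. by rewrite size_map size_enum_ord. Qed.

Lemma nth_code_seq n (w : 'S_n) (c : 'I_n) :
  nth 0 (code_seq w) c = code w (rev_ord c).
Proof. by rewrite (nth_map c) ?size_enum_ord // nth_ord_enum. Qed.

Lemma sumn_code_seq n (w : 'S_n) : sumn (code_seq w) = \sum_m code w m.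
Proof. by rewrite sumnE big_map big_enum /= [RHS](reindex_inj rev_ord_inj). Qed.

Lemma code_seq_inj n : injective (@code_seq n).
Proof.
move=> w w' E; apply: code_inj => m.
by rewrite -[m]rev_ordK -!nth_code_seq E.
Qed.

Lemma code_seq_staircases n :
  perm_eq [seq code_seq w | w : 'S_n <- enum (@avoids231 n)] (staircases n n.+1).
Proof.
apply: uniq_perm; [|exact: staircases_uniq|move=> a].
  by rewrite map_inj_uniq ?enum_uniq //; exact: code_seq_inj.
apply/mapP/staircasesP => [[w]|[sa a0 ak as_]].
  rewrite mem_enum -[_ \in _]/(avoids231 w) avoids231_code => /forallP mono ->; split.
  - exact: size_code_seq.
  - by move=> n0; rewrite (nth_code_seq w (Ordinal n0)) ltnS (leq_trans (code_leq _
    _)) // ltnW.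
  - by move=> k kn; rewrite (nth_code_seq w (Ordinal kn));
    have := code_leq w (rev_ord (Ordinal kn)) => /=; lia.
  move=> k kn; rewrite (nth_code_seq w (Ordinal kn)) (nth_code_seq w (Ordinal (ltnW
    kn))).
  have /forallP/(_ (rev_ord (Ordinal (ltnW kn))))/implyP :=
    mono (rev_ord (Ordinal kn)).
  by apply; rewrite /=; lia.
have [|w cw] := @code_surj n (fun m => nth 0 a (rev_ord m)).
  by move=> m /=; have := ak (n - m.+1); have := ltn_ord m; lia.
exists w.
  rewrite mem_enum -[_ \in _]/(avoids231 w) avoids231_code; apply/forallP => m;
    apply/forallP => m'.
  apply/implyP => /eqP e; rewrite !cw /= e.
  have -> : n - m.+1 = (n - m.+2).+1 by have := ltn_ord m'; lia.
  by apply: as_; have := ltn_ord m'; lia.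
apply: (@eq_from_nth _ 0); rewrite ?size_code_seq // => k.
by rewrite sa => kn; rewrite (nth_code_seq w (Ordinal kn)) cw rev_ordK.
Qed.

Local Open Scope ring_scope.

Definition stair_poly (i t : nat) : {poly int} :=
  \sum_(a <- staircases i t) 'X^(sumn a).

Lemma stair_poly0 t : stair_poly 0 t = 1.
Proof. by rewrite /stair_poly big_seq1. Qed.

Lemma stair_polyS0 i : stair_poly i.+1 0 = 0.
Proof. by rewrite /stair_poly big_nil. Qed.

Lemma sum_leq_recr (i t : nat) (F : nat -> {poly int}) :
  \sum_(j < t.+1 | (j <= i)%N) F j =
    \sum_(j < t | (j <= i)%N) F j + (t <= i)%N%:R * F t.
Proof.
rewrite big_mkcond big_ord_recr -big_mkcond /=; congr (_ + _).
by case: leqP => _; rewrite ?mul1r ?mul0r.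
Qed.

Lemma stair_polySS i t :
  stair_poly i.+1 t.+1 = stair_poly i.+1 t + (t <= i)%N%:R * 'X^t * stair_poly i t.+1.
Proof.
have E u : stair_poly i.+1 u = \sum_(j < u | (j <= i)%N) 'X^j * stair_poly i j.+1.
  rewrite /stair_poly /= big_allpairs_dep /= big_filter.
  have -> : iota 0 u = index_iota 0 u by rewrite /index_iota subn0.
  rewrite big_mkord.
  by apply: eq_bigr => j _; rewrite mulr_sumr; apply: eq_bigr => a _; rewrite -exprD.
by rewrite !E (sum_leq_recr i t (fun j => 'X^j * stair_poly i j.+1)) mulrA.
Qed.

Lemma qfactorS_coefS t k :
  (qfactor t.+1)`_k.+1 = (qfactor t)`_k.+1 - 'X^t * (qfactor t)`_k.
Proof.
rewrite /qfactor big_ord_recr /= mulrBr mulr1 coefB; congr (_ - _).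
by rewrite mulrCA coefCM coefMX.
Qed.

(** Pairs of a sequence a and a set S, with a marked entry j that is larger than all
    of S and at least all of a: j may be appended to a or added to S. This common
    value of two generating functions is what cancels below. *)
Definition marked_sum (i k : nat) : {poly int} :=
  \sum_(j < i.+1) 'X^j * stair_poly i j.+1 * (qfactor j)`_k.

(** Induction on t: the two sums come from the increments in t of the left and of
    the right factor of the product on the left-hand side. *)
Lemma summation_by_parts i k t :
  stair_poly i t * (qfactor t)`_k = stair_poly i 0 * (qfactor 0)`_k
  + (if i is i'.+1 then
       \sum_(j < t | (j <= i')%N) 'X^j * stair_poly i' j.+1 * (qfactor j)`_k
     else 0)
  - (if k is k'.+1 then
       \sum_(j < t) 'X^j * stair_poly i j.+1 * (qfactor j)`_k'
     else 0).
Proof.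
elim: t => [|t IH].
  by case: i k => [|i] [|k]; rewrite ?big_ord0 ?big_pred0 ?subr0 ?addr0 //; case.
have -> : stair_poly i t.+1 * (qfactor t.+1)`_k = stair_poly i t * (qfactor t)`_k
  + (if i is i'.+1 then
       (t <= i')%N%:R * ('X^t * stair_poly i' t.+1 * (qfactor t)`_k)
     else 0)
  - (if k is k'.+1 then 'X^t * stair_poly i t.+1 * (qfactor t)`_k' else 0).
  case: i k {IH} => [|i] [|k]; rewrite ?stair_polySS ?qfactor_coef0 ?qfactorS_coefS
    ?stair_poly0;
    try (move: (_%:R) => b); try (move: ('X^t) => x); ring.
by rewrite IH; case: i k {IH} => [|i] [|k];
  rewrite ?big_ord_recr
    ?(sum_leq_recr _ _ (fun j => 'X^j * stair_poly _ j.+1 * (qfactor j)`__)) /=;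
      try (move: (_%:R) => b);
  try (move: ('X^t) => x); ring.
Qed.

Lemma qfactor0_coef k : (qfactor 0)`_k = (k == 0)%N%:R.
Proof. by rewrite /qfactor big_ord0 coef1. Qed.

(** An entry coming from S ranges over 0, ..., i, as does the last entry of a
    sequence of length i + 1; the last entry of a sequence of length i ranges over
    0, ..., i - 1. So both sums are marked sums, for the lengths i and i - 1 of the
    sequence without the marked entry. *)
Lemma telescoping_term i k :
  stair_poly i i.+1 * (qfactor i.+1)`_k = ((i == 0) && (k == 0))%N%:R
  + (if i is i'.+1 then marked_sum i' k else 0)
  - (if k is k'.+1 then marked_sum i k' else 0).
Proof.
rewrite summation_by_parts qfactor0_coef; congr (_ + _ - _).
  by case: i => [|i]; rewrite ?stair_poly0 ?stair_polyS0 ?mul1r ?mul0r.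
case: i => // i; rewrite (sum_leq_recr _ _ (fun j =>
  'X^j * stair_poly i j.+1 * (qfactor j)`_k)) ltnn mul0r addr0.
by apply: eq_bigl => j; rewrite -ltnS ltn_ord.
Qed.

Lemma qCatalan_stair_poly : qCatalan (fun i => stair_poly i i.+1).
Proof.
apply/qCatalanP => m.
have partial p : (p <= m)%N ->
    \sum_(i < p.+1) stair_poly i i.+1 * (qfactor i.+1)`_(m - i)
    = (m == 0)%N%:R - (if (p < m)%N then marked_sum p (m - p).-1 else 0).
  elim: p => [|p IH] pm.
    rewrite big_ord_recl big_ord0 addr0 telescoping_term subn0 addr0.
    by case: m pm => [|m] _ //=; rewrite subn0.
  rewrite big_ord_recr (IH (ltnW pm)) pm telescoping_term.
  have [d dE] : exists d, (m - p.+1)%N = d by exists (m - p.+1)%N.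
  rewrite /= add0r dE.
  have -> : (m - p).-1 = d by lia.
  have -> : (p.+1 < m)%N = (0 < d)%N by lia.
  by case: d {dE} => [|d] /=; rewrite ?subr0 ?addrA subrK.
by rewrite partial // ltnn subr0.
Qed.

Unset Implicit Arguments.

Theorem proposition5p11 (n : nat) (C : nat -> {poly int}) :
  (1 <= n)%N -> qCatalan C ->
  let q : {fraction {poly int}} := tofrac 'X in
  \sum_(w : 'S_n | avoids231 w) q ^+ tiling_weight (tiling_of w)
  = q ^+ 'C(n, 2) * (map_poly intr (C n)).[q^-1].
Proof.
move=> _ CP q; rewrite (qCatalan_unique CP qCatalan_stair_poly).
have q_unit : q \is a GRing.unit by rewrite unitfE tofrac_eq0 polyX_eq0.
rewrite /stair_poly rmorph_sum /= horner_sum mulr_sumr.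
rewrite -(perm_big _ (code_seq_staircases n)) big_map big_enum /=.
apply: eq_bigr => w _; rewrite map_polyXn hornerXn exprVn sumn_code_seq
  weight_tiling_of.
rewrite sumnB => [|m _]; last exact: code_leq.
have -> : 'C(n, 2) = (\sum_(m < n) m)%N by rewrite -bin2_sum big_mkord.
by rewrite exprB // leq_sum // => m _; exact: code_leq.
Qed.
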